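(* Let $\mu\in(0,+\infty)$ and let $f:[0,+\infty)\to\mathbb{R}$ be a $C^1$ function satisfying $$f(0)=f(1)=0,\quad f'(1)<0,\quad f(u)<0\ \text{ for } u>1.$$ Assume that $(c^*,q_{c^*})$, with $c^*\in\mathbb{R}$ and $q_{c^*}\in C^2([0,+\infty))$, is a solution $(c,q)$ of $$q''-cq'+f(q)=0\ \text{in}\ (0,+\infty),\quad q(z)>0\ \text{in}\ (0,+\infty),\quad q(0)=0,\quad q(+\infty)=1,\quad q'(0)=\frac{c}{\mu}.$$ Then $q_{c^*}'(x)>0$ for all $x\ge0$. Moreover, $(c^*,q_{c^*})$ is the unique solution $(c,q)$ of this problem.
   Context: Here $q(+\infty)=\lim_{z\to+\infty}q(z)$. The constant $c$ is part of the unknown. *)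

(* Defs.v *)
From Stdlib Require Import Reals.
From Coquelicot Require Import Coquelicot.
Open Scope R_scope.

(* Functions on [0,+oo) are represented by total functions R -> R whose values
   on negative arguments are never constrained. *)
Definition half_line (x : R) : Prop := 0 <= x.

(* [D_in] and [continue_in] take limits within [half_line]: one-sided at 0,
   the ordinary two-sided notions at every x > 0. *)
Definition C1_half_line (g dg : R -> R) : Prop :=
  forall x, half_line x -> D_in g dg half_line x /\ continue_in dg half_line x.

Definition C2_half_line (g dg ddg : R -> R) : Prop :=
  (forall x, half_line x -> D_in g dg half_line x) /\ C1_half_line dg ddg.

(* dq and ddq are q' and q''; the speed c is part of the unknown. *)
Record semi_wave (mu : R) (f : R -> R) (c : R) (q dq ddq : R -> R) : Prop := {
  semi_wave_C2 : C2_half_line q dq ddq;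
  semi_wave_eq : forall z, 0 < z -> ddq z - c * dq z + f (q z) = 0;
  semi_wave_pos : forall z, 0 < z -> 0 < q z;
  semi_wave_0 : q 0 = 0;
  semi_wave_infty : is_lim q p_infty 1;
  semi_wave_slope : dq 0 = c / mu
}.

(* Main.v *)
Require Import Defs.
From Stdlib Require Import Reals Lra.
From Coquelicot Require Import Coquelicot.
Open Scope R_scope.

(** Both claims come from one sliding argument ([sliding]).  Given two profiles
    [q1], [q2] of speeds [c1 <= c2], compare [q2] with the translates
    [q1 (z + s)].  When [s] is large, [q2] lies below: on a compact set because
    [q2 < 1] there, and beyond it by the maximum principle.  Lower [s] as long as this order persists.  It can only
    fail at some [s > 0] in one of two ways.  Either the graphs touch at a point
    [z > 0] ([z = 0] is excluded by [q1 s > 0 = q2 0]), or the order is lost at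
    infinity.  The latter is excluded by the maximum principle, as [f] is
    decreasing near the limit value 1 ([gap_far]).  As for touching
    ([no_touching]), if [c1 = c2] it makes both functions solutions of the same
    Cauchy problem, and following them backward to [z = 0] contradicts
    [q1 s > 0 = q2 0]; if [c1 < c2] and [q2] is increasing, then at the touching
    point the second derivative of [q1 (z + s) - q2 z] equals
    [(c1 - c2) * q2' < 0], which is impossible at a minimum.  Hence
    [q2 z <= q1 (z + s)] for every [s > 0].

    Comparing a profile with itself shows that it is nondecreasing.  Its
    derivative cannot vanish: a zero would be a minimum of [q'], so [q''] and then
    [f q] would vanish there, and the orbit would rest at an equilibrium
    ([profile_slope_pos]).

    For two semi-waves of speeds [c1 < c2], letting [s] tend to 0 gives
    [q2 <= q1] with equality at 0, hence [q2' 0 <= q1' 0], that is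
    [c2 / mu <= c1 / mu], a contradiction ([speed_le]).  So the speeds agree; then
    the initial data [(0, c / mu)] agree as well and the Cauchy problem has only
    one solution. *)

(** * Calculus on intervals *)

(** Unlike in [MVT_gen], the intermediate point lies strictly inside the interval,
    so [g] need not be differentiable at the endpoints. *)
Lemma mean_value (g dg : R -> R) (a b : R) (Hab : a < b)
  (Hc : continuity g) (Hd : forall z, a < z < b -> is_derive g z (dg z)) :
  exists z, a < z < b /\ g b - g a = dg z * (b - a).
Proof.
  assert (pr : forall z, a < z < b -> derivable_pt g z).
  { intros z Hz. exists (dg z). apply is_derive_Reals, Hd, Hz. }
  destruct (MVT g id a b pr (fun z _ => derivable_pt_id z) Hab
              (fun z _ => Hc z)
              (fun z _ => derivable_continuous_pt _ _ (derivable_pt_id z)))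
    as [z [Hz E]].
  exists z. split; [exact Hz|].
  rewrite (derive_pt_eq_0 g z (dg z)) in E by (apply is_derive_Reals, Hd, Hz).
  rewrite (derive_pt_eq_0 id z 1) in E by apply derivable_pt_lim_id.
  unfold id in E. lra.
Qed.

Lemma continuity_shift (g : R -> R) (s : R) :
  continuity g -> continuity (fun z => g (z + s)).
Proof.
  intros Hg z. apply (continuity_pt_comp (fun y => y + s) g).
  - reg.
  - apply Hg.
Qed.

Lemma is_derive_shift (g : R -> R) (s z l : R) :
  is_derive g (z + s) l -> is_derive (fun y => g (y + s)) z l.
Proof.
  intros Hg. evar_last.
  - apply (is_derive_comp g (fun y => y + s)); [exact Hg|].
    auto_derive; [exact I|reflexivity].
  - unfold scal; simpl; unfold mult; simpl. ring.
Qed.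

Lemma near_of_continuity (g : R -> R) (a eps : R) :
  continuity_pt g a -> 0 < eps ->
  exists d, 0 < d /\ forall z, Rabs (z - a) < d -> Rabs (g z - g a) < eps.
Proof.
  intros Hg He. destruct (Hg eps He) as [d [Hd H]].
  exists d. split; [exact Hd|]. intros z Hz.
  destruct (Req_dec z a) as [->|Hne].
  - rewrite Rminus_diag, Rabs_R0. exact He.
  - apply (H z). split; [|exact Hz].
    split; [exact I|]. intros E; apply Hne; symmetry; exact E.
Qed.

(** Nothing is asked of the derivative of [u] at [a] itself, so that the lemma
    applies at the end of the half-line: [v] is negative on some interval to the
    right of [a], where [u] strictly decreases. *)
Lemma initial_descent (u v : R -> R) (a : R)
  (Hu : continuity u) (Hv : continuity v)
  (Hd : forall z, a < z -> is_derive u z (v z)) (Hneg : v a < 0) :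
  exists z, a < z /\ u z < u a.
Proof.
  destruct (near_of_continuity v a (- v a) (Hv a)) as [d [Hd0 Hnear]]; [lra|].
  exists (a + d / 2). split; [lra|].
  destruct (mean_value u v a (a + d / 2)) as [z [Hz E]];
    [lra|exact Hu|intros z Hz; apply Hd; lra|].
  assert (Hvz : v z < 0).
  { assert (H : Rabs (z - a) < d) by (apply Rabs_def1; lra).
    apply Hnear, Rabs_def2 in H. lra. }
  assert (v z * (a + d / 2 - a) < 0)
    by (replace (a + d / 2 - a) with (d / 2) by ring; nra).
  lra.
Qed.

Lemma min_second_derivative (w v : R -> R) (z e d : R) (He : 0 < e)
  (Hw : continuity w)
  (Hd : forall y, Rabs (y - z) < e -> is_derive w y (v y))
  (Hmin : forall y, Rabs (y - z) < e -> w z <= w y)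
  (Hv : is_derive v z d) :
  v z = 0 /\ 0 <= d.
Proof.
  assert (Hz0 : v z = 0).
  { assert (pr : derivable_pt w z).
    { exists (v z). apply is_derive_Reals, Hd.
      rewrite Rminus_diag, Rabs_R0. exact He. }
    rewrite <- (derive_pt_eq_0 w z (v z) pr).
    - apply (deriv_minimum w (z - e) (z + e)); try lra.
      intros y H1 H2. apply Hmin, Rabs_def1; lra.
    - apply is_derive_Reals, Hd. rewrite Rminus_diag, Rabs_R0. exact He. }
  split; [exact Hz0|].
  destruct (Rle_or_lt 0 d) as [H|Hneg]; [exact H|exfalso].
  (* If [d < 0] then [v < 0] just to the right of [z], so [w] dips below
     its minimum. *)
  apply is_derive_Reals in Hv.
  destruct (Hv (- d)) as [r Hr]; [lra|].
  assert (Hr0 := cond_pos r).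
  set (t := Rmin r e / 2).
  assert (Ht : 0 < t /\ t < r /\ t < e).
  { unfold t. assert (0 < Rmin r e) by (apply Rmin_pos; lra).
    pose proof (Rmin_l r e). pose proof (Rmin_r r e). lra. }
  destruct (mean_value w v z (z + t)) as [y [Hy E]];
    [lra|exact Hw|intros y Hy; apply Hd, Rabs_def1; lra|].
  assert (Hvy : v y < 0).
  { specialize (Hr (y - z)). replace (z + (y - z)) with y in Hr by ring.
    rewrite Hz0 in Hr.
    assert (Hq : Rabs ((v y - 0) / (y - z) - d) < - d).
    { apply Hr; [lra|apply Rabs_def1; lra]. }
    apply Rabs_def2 in Hq.
    assert (Hneg' : v y / (y - z) < 0)
      by (replace (v y / (y - z)) with ((v y - 0) / (y - z)) by (field; lra); lra).
    replace (v y) with (v y / (y - z) * (y - z)) by (field; lra). nra. }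
  assert (w z <= w (z + t)) by (apply Hmin, Rabs_def1; lra).
  replace (z + t - z) with t in E by ring. nra.
Qed.

Definition tends_to (g : R -> R) (l : R) : Prop :=
  forall eps, 0 < eps -> exists M, forall z, M <= z -> Rabs (g z - l) < eps.

Lemma min_attained (g : R -> R) (l a z1 : R)
  (Hc : continuity g) (Hl : tends_to g l) (Hz1 : a <= z1) (Hlt : g z1 < l) :
  exists zm, a <= zm /\ g zm <= g z1 /\ forall z, a <= z -> g zm <= g z.
Proof.
  destruct (Hl (l - g z1)) as [M HM]; [lra|].
  set (b := Rmax z1 M).
  assert (Hb1 : z1 <= b) by apply Rmax_l.
  assert (Hb2 : M <= b) by apply Rmax_r.
  destruct (continuity_ab_min g a b) as [zm [Hmin Hzm]];
    [lra|intros z _; apply Hc|].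
  assert (Hm1 : g zm <= g z1) by (apply Hmin; lra).
  exists zm. split; [lra|]. split; [exact Hm1|].
  intros z Hz. destruct (Rle_or_lt z b) as [Hzb|Hzb].
  - apply Hmin; lra.
  - assert (H := HM z ltac:(lra)). apply Rabs_def2 in H. lra.
Qed.

(** * Uniqueness for the initial value problem *)

Lemma gronwall (E dE : R -> R) (K a b t0 : R)
  (Hc : continuity E) (Hd : forall z, a < z < b -> is_derive E z (dE z))
  (HK : forall z, a < z < b -> Rabs (dE z) <= K * E z)
  (Ht0 : a <= t0 <= b) (H0 : E t0 = 0) :
  forall t, a <= t <= b -> E t <= 0.
Proof.
  intros t Ht.
  assert (Hexp : forall k, continuity (fun z => E z * exp (k * z)))
    by (intros k; reg).
  assert (Hder : forall k z, a < z < b ->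
      is_derive (fun z => E z * exp (k * z)) z ((dE z + k * E z) * exp (k * z))).
  { intros k z Hz. evar_last.
    - apply (is_derive_mult E (fun z => exp (k * z)) z (dE z) (k * exp (k * z))).
      + apply Hd, Hz.
      + auto_derive; [exact I|ring].
      + intros; apply Rmult_comm.
    - unfold plus, mult; simpl. ring. }
  destruct (Rtotal_order t0 t) as [Hlt|[Heq|Hgt]].
  - (* Forward in time, [E z * exp (- K z)] is nonincreasing. *)
    destruct (mean_value _
      (fun z => (dE z + - K * E z) * exp (- K * z)) t0 t Hlt (Hexp (- K))) as [z [Hz Ez]].
    { intros z Hz. apply Hder. lra. }
    cbv beta in Ez. rewrite H0 in Ez.
    assert (HKz := HK z ltac:(lra)).
    pose proof (Rle_abs (dE z)).
    pose proof (exp_pos (- K * z)). pose proof (exp_pos (- K * t)).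
    assert ((dE z + - K * E z) * exp (- K * z) <= 0) by nra.
    assert (E t * exp (- K * t) <= 0) by nra.
    nra.
  - subst. lra.
  - (* Backward in time, [E z * exp (K z)] is nondecreasing. *)
    destruct (mean_value _
      (fun z => (dE z + K * E z) * exp (K * z)) t t0 Hgt (Hexp K)) as [z [Hz Ez]].
    { intros z Hz. apply Hder. lra. }
    cbv beta in Ez. rewrite H0 in Ez.
    assert (HKz := HK z ltac:(lra)).
    pose proof (Rle_abs (- dE z)). rewrite Rabs_Ropp in H.
    pose proof (exp_pos (K * z)). pose proof (exp_pos (K * t)).
    assert (0 <= (dE z + K * E z) * exp (K * z)) by nra.
    assert (E t * exp (K * t) <= 0) by nra.
    nra.
Qed.

Definition solves_on (f : R -> R) (c : R) (q p : R -> R) (a b : R) : Prop :=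
  forall z, a < z < b ->
    is_derive q z (p z) /\ is_derive p z (c * p z - f (q z)) /\ 0 <= q z <= 1.

Definition lipschitz_unit (f : R -> R) : Prop :=
  exists L, 0 <= L /\ forall u v, 0 <= u <= 1 -> 0 <= v <= 1 ->
    Rabs (f u - f v) <= L * Rabs (u - v).

(** Grönwall's lemma for the squared phase-plane distance of the two orbits. *)
Lemma ivp_unique (f : R -> R) (c : R) (q1 p1 q2 p2 : R -> R) (a b t0 : R)
  (HL : lipschitz_unit f)
  (Hq1 : continuity q1) (Hp1 : continuity p1)
  (Hq2 : continuity q2) (Hp2 : continuity p2)
  (H1 : solves_on f c q1 p1 a b) (H2 : solves_on f c q2 p2 a b)
  (Ht0 : a <= t0 <= b) (Eq : q1 t0 = q2 t0) (Ep : p1 t0 = p2 t0) :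
  forall t, a <= t <= b -> q1 t = q2 t.
Proof.
  intros t Ht. destruct HL as [L [HL0 HL]].
  set (E := fun z => (q1 z - q2 z) ^ 2 + (p1 z - p2 z) ^ 2).
  assert (HE : E t <= 0).
  { apply (gronwall E
      (fun z => 2 * (q1 z - q2 z) * (p1 z - p2 z)
        + 2 * (p1 z - p2 z) * (c * (p1 z - p2 z) - (f (q1 z) - f (q2 z))))
      (1 + 2 * Rabs c + L) a b t0); try assumption.
    - unfold E. reg.
    - intros z Hz. destruct (H1 z Hz) as [A1 [B1 _]].
      destruct (H2 z Hz) as [A2 [B2 _]]. unfold E.
      auto_derive.
      + repeat split; eexists; eassumption.
      + (* The derivatives are met in the order [q1], [q2], [p1], [p2]. *)
        replace (Derive _ z) with (p1 z)
          by (symmetry; apply is_derive_unique, A1).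
        replace (Derive _ z) with (p2 z)
          by (symmetry; apply is_derive_unique, A2).
        replace (Derive _ z) with (c * p1 z - f (q1 z))
          by (symmetry; apply is_derive_unique, B1).
        replace (Derive _ z) with (c * p2 z - f (q2 z))
          by (symmetry; apply is_derive_unique, B2).
        ring.
    - intros z Hz. destruct (H1 z Hz) as [_ [_ R1]].
      destruct (H2 z Hz) as [_ [_ R2]].
      assert (Hf := HL _ _ R1 R2). unfold E.
      set (w := q1 z - q2 z) in *. set (v := p1 z - p2 z).
      set (h := f (q1 z) - f (q2 z)) in *.
      replace (2 * w * v + 2 * v * (c * v - h))
        with (2 * (w * v) + 2 * (c * v ^ 2) + - (2 * (v * h))) by ring.
      eapply Rle_trans; [apply Rabs_triang|].
      rewrite Rabs_Ropp.
      eapply Rle_trans; [apply Rplus_le_compat_r, Rabs_triang|].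
      rewrite !Rabs_mult, (Rabs_right 2) by lra.
      rewrite (Rabs_right (v ^ 2)) by (apply Rle_ge, pow2_ge_0).
      rewrite <- (pow2_abs w), <- (pow2_abs v).
      pose proof (Rabs_pos w). pose proof (Rabs_pos v). pose proof (Rabs_pos c).
      set (W := Rabs w) in *. set (V := Rabs v) in *.
      assert (V * Rabs h <= V * (L * W)) by (apply Rmult_le_compat_l; lra).
      assert (0 <= (W - V) ^ 2) by apply pow2_ge_0.
      assert (0 <= L * (W - V) ^ 2) by (apply Rmult_le_pos; lra).
      assert (0 <= Rabs c * W ^ 2)
        by (apply Rmult_le_pos; [lra|apply pow2_ge_0]).
      nra.
    - unfold E. rewrite Eq, Ep. ring. }
  unfold E in HE.
  pose proof (pow2_ge_0 (q1 t - q2 t)). pose proof (pow2_ge_0 (p1 t - p2 t)).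
  assert (q1 t - q2 t = 0) by (apply Rsqr_0_uniq; unfold Rsqr; lra).
  lra.
Qed.

(** * Functions on the half-line *)

(** Extending by the value at 0 makes one-sided continuity at 0 two-sided,
    while derivatives at positive points are unchanged. *)
Definition clamp (g : R -> R) (z : R) : R := g (Rmax 0 z).

Lemma clamp_eq (g : R -> R) (z : R) : 0 <= z -> clamp g z = g z.
Proof. intros Hz. unfold clamp. rewrite Rmax_right by lra. reflexivity. Qed.

Lemma clamp_continuity (g : R -> R) :
  (forall x, half_line x -> continue_in g half_line x) -> continuity (clamp g).
Proof.
  intros Hg x. unfold clamp. intros eps He.
  destruct (Hg (Rmax 0 x) (Rmax_l 0 x) eps He) as [d [Hd H]].
  exists d. split; [exact Hd|]. simpl in *. unfold Rdist in *.
  intros y [_ Hy].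
  destruct (Req_dec (Rmax 0 x) (Rmax 0 y)) as [<-|Hne].
  - rewrite Rminus_diag, Rabs_R0. exact He.
  - apply H. split.
    + split; [apply Rmax_l|exact Hne].
    + eapply Rle_lt_trans; [|exact Hy].
      unfold Rmax, Rabs.
      destruct (Rle_dec 0 y), (Rle_dec 0 x);
        repeat destruct Rcase_abs; lra.
Qed.

Lemma clamp_derive (g dg : R -> R) (z : R) :
  (forall x, half_line x -> D_in g dg half_line x) -> 0 < z ->
  is_derive (clamp g) z (clamp dg z).
Proof.
  intros Hg Hz. rewrite (clamp_eq dg) by lra.
  apply is_derive_Reals. intros eps He.
  destruct (Hg z (Rlt_le _ _ Hz) eps He) as [d [Hd H]].
  assert (Hm : 0 < Rmin d z) by (apply Rmin_pos; lra).
  exists (mkposreal _ Hm). simpl. intros h Hh0 Hh.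
  pose proof (Rmin_l d z). pose proof (Rmin_r d z).
  assert (Hh2 := Rabs_def2 _ _ Hh).
  rewrite !clamp_eq by lra.
  specialize (H (z + h)). simpl in H. unfold Rdist in H.
  replace (z + h - z) with h in H by ring.
  apply H. split; [|lra]. split; [unfold half_line; lra|lra].
Qed.

(** * The nonlinearity *)

Lemma C1_lipschitz_unit (f df : R -> R) :
  C1_half_line f df -> lipschitz_unit f.
Proof.
  intros Hf.
  assert (Hcf : continuity (clamp f))
    by (apply clamp_continuity; intros x Hx; apply cont_deriv with (d := df);
        apply Hf, Hx).
  assert (Hcd : continuity (clamp df))
    by (apply clamp_continuity; intros x Hx; apply Hf, Hx).
  destruct (continuity_ab_maj (fun z => Rabs (clamp df z)) 0 1) as [m [Hm _]];
    [lra| |].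
  { intros z _. apply (continuity_pt_comp (clamp df) Rabs);
      [apply Hcd|apply Rcontinuity_abs]. }
  exists (Rabs (clamp df m)). split; [apply Rabs_pos|].
  assert (Hlt : forall u v, 0 <= u <= 1 -> 0 <= v <= 1 -> u < v ->
    Rabs (f v - f u) <= Rabs (clamp df m) * Rabs (v - u)).
  { intros u v Hu Hv Huv.
    destruct (mean_value (clamp f) (clamp df) u v Huv Hcf) as [z [Hz E]].
    { intros z Hz. apply clamp_derive; [|lra]. intros x Hx; apply Hf, Hx. }
    rewrite !clamp_eq with (g := f) in E by lra.
    rewrite E, Rabs_mult. apply Rmult_le_compat_r; [apply Rabs_pos|].
    apply Hm. lra. }
  intros u v Hu Hv. destruct (Rtotal_order u v) as [H|[->|H]].
  - rewrite (Rabs_minus_sym (f u)), (Rabs_minus_sym u). auto.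
  - rewrite !Rminus_diag, Rabs_R0. lra.
  - auto.
Qed.

Definition decreasing_below_one (f : R -> R) (d : R) : Prop :=
  0 < d < 1 /\ forall u v, 1 - d <= u -> u < v -> v <= 1 -> f v < f u.

Lemma C1_decreasing_below_one (f df : R -> R) :
  C1_half_line f df -> df 1 < 0 -> exists d, decreasing_below_one f d.
Proof.
  intros Hf H1.
  assert (Hcf : continuity (clamp f))
    by (apply clamp_continuity; intros x Hx; apply cont_deriv with (d := df);
        apply Hf, Hx).
  assert (Hcd : continuity (clamp df))
    by (apply clamp_continuity; intros x Hx; apply Hf, Hx).
  destruct (near_of_continuity (clamp df) 1 (- df 1) (Hcd 1)) as [r [Hr Hnear]];
    [lra|].
  rewrite (clamp_eq df 1) in Hnear by lra.
  set (d := Rmin r 1 / 2).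
  assert (Hd : 0 < d /\ d < r /\ d < 1).
  { unfold d. assert (0 < Rmin r 1) by (apply Rmin_pos; lra).
    pose proof (Rmin_l r 1). pose proof (Rmin_r r 1). lra. }
  exists d. split; [lra|]. intros u v Hu Huv Hv.
  destruct (mean_value (clamp f) (clamp df) u v Huv Hcf) as [z [Hz E]].
  { intros z Hz. apply clamp_derive; [|lra]. intros x Hx; apply Hf, Hx. }
  rewrite !clamp_eq with (g := f) in E by lra.
  assert (Hn : Rabs (clamp df z - df 1) < - df 1)
    by (apply Hnear, Rabs_def1; lra).
  apply Rabs_def2 in Hn. nra.
Qed.

(** * Profiles *)

(** A semi-wave seen as an orbit of the phase-plane system [q' = p],
    [p' = c p - f q], free of the condition on the slope at 0: sliding does not
    involve it. *)
Record profile (f : R -> R) (c : R) (q p : R -> R) : Prop := {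
  profile_cont_q : continuity q;
  profile_cont_p : continuity p;
  profile_derive_q : forall z, 0 < z -> is_derive q z (p z);
  profile_derive_p : forall z, 0 < z -> is_derive p z (c * p z - f (q z));
  profile_pos : forall z, 0 < z -> 0 < q z;
  profile_0 : q 0 = 0;
  profile_infty : tends_to q 1
}.

Lemma semi_wave_profile (mu : R) (f : R -> R) (c : R) (q dq ddq : R -> R) :
  semi_wave mu f c q dq ddq -> profile f c (clamp q) (clamp dq).
Proof.
  intros [[Dq C1] He Hp H0 Hinf _]. constructor.
  - apply clamp_continuity. intros x Hx. apply cont_deriv with (d := dq), Dq, Hx.
  - apply clamp_continuity. intros x Hx. apply cont_deriv with (d := ddq), C1, Hx.
  - intros z Hz. apply clamp_derive; assumption.
  - intros z Hz. evar_last.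
    + apply (clamp_derive dq ddq); [|exact Hz]. intros x Hx. apply C1, Hx.
    + rewrite !clamp_eq by lra. specialize (He z Hz). lra.
  - intros z Hz. rewrite clamp_eq by lra. auto.
  - rewrite clamp_eq by lra. exact H0.
  - intros eps Heps. apply is_lim_spec in Hinf.
    destruct (Hinf (mkposreal eps Heps)) as [M HM]. simpl in HM.
    exists (Rmax 0 (M + 1)). intros z Hz.
    pose proof (Rmax_l 0 (M + 1)). pose proof (Rmax_r 0 (M + 1)).
    rewrite clamp_eq by lra. apply HM. lra.
Qed.

(** At an interior maximum with value above 1, the equation gives
    [q'' = - f q > 0]. *)
Lemma profile_le_1 (f : R -> R) (c : R) (q p : R -> R)
  (Hfneg : forall u, 1 < u -> f u < 0) (Hq : profile f c q p) :
  forall z, 0 <= z -> q z <= 1.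
Proof.
  destruct Hq as [Cq Cp Dq Dp Pos Q0 Inf].
  intros z1 Hz1. apply Rnot_lt_le. intros Hgt.
  destruct (min_attained (fun z => - q z) (-1) 0 z1) as [zm [Hzm [Hm1 Hmin]]];
    [reg| |exact Hz1|lra|].
  { intros eps He. destruct (Inf eps He) as [M HM]. exists M. intros z Hz.
    replace (- q z - -1) with (- (q z - 1)) by ring.
    rewrite Rabs_Ropp. auto. }
  assert (Hzm0 : 0 < zm).
  { destruct (Req_dec zm 0) as [->|]; lra. }
  destruct (min_second_derivative (fun z => - q z) (fun z => - p z) zm zm
              (- (c * p zm - f (q zm)))) as [Hp Hdd].
  - exact Hzm0.
  - reg.
  - intros y Hy. apply Rabs_def2 in Hy.
    apply (is_derive_opp q), Dq. lra.
  - intros y Hy. apply Rabs_def2 in Hy. apply Hmin. lra.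
  - apply (is_derive_opp p), Dp, Hzm0.
  - assert (f (q zm) < 0) by (apply Hfneg; lra).
    replace (p zm) with 0 in Hdd by lra. lra.
Qed.

Lemma profile_range (f : R -> R) (c : R) (q p : R -> R)
  (Hfneg : forall u, 1 < u -> f u < 0) (Hq : profile f c q p) :
  forall z, 0 <= z -> 0 <= q z <= 1.
Proof.
  intros z Hz. split; [|apply (profile_le_1 f c q p); assumption].
  destruct (Req_dec z 0) as [->|Hne].
  - rewrite (profile_0 _ _ _ _ Hq). lra.
  - apply Rlt_le, (profile_pos _ _ _ _ Hq). lra.
Qed.

Lemma profile_solves_on (f : R -> R) (c : R) (q p : R -> R) (s a b : R)
  (Hfneg : forall u, 1 < u -> f u < 0) (Hq : profile f c q p)
  (Hs : 0 <= s) (Ha : 0 <= a) :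
  solves_on f c (fun z => q (z + s)) (fun z => p (z + s)) a b.
Proof.
  intros z Hz. split; [|split].
  - apply is_derive_shift, (profile_derive_q _ _ _ _ Hq). lra.
  - apply is_derive_shift, (profile_derive_p _ _ _ _ Hq). lra.
  - apply (profile_range f c q p); [assumption..|lra].
Qed.

(** Agreement propagates in both directions.  Touching profiles are followed
    backward, to the boundary value at 0; profiles with equal initial data are
    followed forward. *)
Lemma profile_shift_unique (f : R -> R) (c : R) (q1 p1 q2 p2 : R -> R) (s t0 t : R)
  (HL : lipschitz_unit f) (Hfneg : forall u, 1 < u -> f u < 0)
  (H1 : profile f c q1 p1) (H2 : profile f c q2 p2)
  (Hs : 0 <= s) (Ht0 : 0 <= t0) (Ht : 0 <= t)
  (Eq : q1 (t0 + s) = q2 t0) (Ep : p1 (t0 + s) = p2 t0) :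
  q1 (t + s) = q2 t.
Proof.
  apply (ivp_unique f c (fun z => q1 (z + s)) (fun z => p1 (z + s)) q2 p2
           0 (Rmax t0 t) t0 HL).
  - apply continuity_shift, H1.
  - apply continuity_shift, H1.
  - apply H2.
  - apply H2.
  - apply profile_solves_on; [assumption..|lra].
  - intros z Hz. split; [|split].
    + apply (profile_derive_q _ _ _ _ H2); lra.
    + apply (profile_derive_p _ _ _ _ H2); lra.
    + apply (profile_range f c q2 p2); [assumption..|lra].
  - split; [exact Ht0|apply Rmax_l].
  - exact Eq.
  - exact Ep.
  - split; [exact Ht|apply Rmax_r].
Qed.

(** By uniqueness, an orbit that meets a rest point of the phase plane is
    constant, while [q 0 = 0 < q 1]. *)
Lemma profile_not_rest (f : R -> R) (c : R) (q p : R -> R) (z : R)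
  (HL : lipschitz_unit f) (Hfneg : forall u, 1 < u -> f u < 0)
  (Hq : profile f c q p) (Hz : 0 <= z) (Hf : f (q z) = 0) :
  p z <> 0.
Proof.
  intros Hp.
  assert (Hconst : forall t, 0 <= t -> q t = q z).
  { intros t Ht.
    apply (ivp_unique f c q p (fun _ => q z) (fun _ => 0) 0 (Rmax z t) z HL).
    - apply Hq.
    - apply Hq.
    - reg.
    - reg.
    - intros y Hy. split; [|split].
      + apply (profile_derive_q _ _ _ _ Hq); lra.
      + apply (profile_derive_p _ _ _ _ Hq); lra.
      + apply (profile_range f c q p); [assumption..|lra].
    - intros y _. rewrite Hf. split; [|split].
      + auto_derive; [exact I|ring].
      + auto_derive; [exact I|ring].
      + apply (profile_range f c q p); assumption.
    - split; [exact Hz|apply Rmax_l].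
    - reflexivity.
    - exact Hp.
    - split; [exact Ht|apply Rmax_r]. }
  assert (E0 := Hconst 0 ltac:(lra)). assert (E1 := Hconst 1 ltac:(lra)).
  assert (H1 := profile_pos _ _ _ _ Hq 1 ltac:(lra)).
  rewrite (profile_0 _ _ _ _ Hq) in E0. lra.
Qed.

(** At a point where [q = 1], an interior maximum, the orbit would be at rest. *)
Lemma profile_lt_1 (f : R -> R) (c : R) (q p : R -> R)
  (HL : lipschitz_unit f) (Hfneg : forall u, 1 < u -> f u < 0) (Hf1 : f 1 = 0)
  (Hq : profile f c q p) :
  forall z, 0 <= z -> q z < 1.
Proof.
  intros z Hz.
  destruct (profile_le_1 f c q p Hfneg Hq z Hz) as [H|E]; [exact H|exfalso].
  assert (Hz0 : 0 < z).
  { destruct (Req_dec z 0) as [->|]; [|lra].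
    rewrite (profile_0 _ _ _ _ Hq) in E. lra. }
  apply (profile_not_rest f c q p z HL Hfneg Hq Hz); [rewrite E; exact Hf1|].
  destruct (min_second_derivative (fun y => - q y) (fun y => - p y) z z
              (- (c * p z - f (q z)))) as [Hp _]; [exact Hz0| | | | |lra].
  - pose proof (profile_cont_q _ _ _ _ Hq). reg.
  - intros y Hy. apply Rabs_def2 in Hy.
    apply (is_derive_opp q), (profile_derive_q _ _ _ _ Hq). lra.
  - intros y Hy. apply Rabs_def2 in Hy.
    pose proof (profile_le_1 f c q p Hfneg Hq y ltac:(lra)). lra.
  - apply (is_derive_opp p), (profile_derive_p _ _ _ _ Hq), Hz0.
Qed.

(** A negative slope would make [q] negative, and a zero slope would place the
    orbit at the rest point [(0, 0)]. *)
Lemma profile_slope_0_pos (f : R -> R) (c : R) (q p : R -> R)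
  (HL : lipschitz_unit f) (Hfneg : forall u, 1 < u -> f u < 0) (Hf0 : f 0 = 0)
  (Hq : profile f c q p) : 0 < p 0.
Proof.
  destruct (Rtotal_order (p 0) 0) as [H|[H|H]]; [exfalso|exfalso|exact H].
  - destruct (initial_descent q p 0) as [z [Hz Hlt]]; try apply Hq; [exact H|].
    rewrite (profile_0 _ _ _ _ Hq) in Hlt.
    pose proof (profile_pos _ _ _ _ Hq z Hz). lra.
  - apply (profile_not_rest f c q p 0 HL Hfneg Hq); [lra| |exact H].
    rewrite (profile_0 _ _ _ _ Hq). exact Hf0.
Qed.

(** * Sliding *)

Section Sliding.

Variables (f : R -> R) (d c1 c2 : R) (q1 p1 q2 p2 : R -> R).
Hypothesis HL : lipschitz_unit f.
Hypothesis Hd : decreasing_below_one f d.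
Hypothesis Hf1 : f 1 = 0.
Hypothesis Hfneg : forall u, 1 < u -> f u < 0.
Hypothesis H1 : profile f c1 q1 p1.
Hypothesis H2 : profile f c2 q2 p2.

(** At equal speeds both profiles solve the same equation; at a smaller speed
    [c1], an increasing [q2] is a strict subsolution of the equation of [q1]. *)
Hypothesis Hspeed : c1 = c2 \/ (c1 < c2 /\ forall z, 0 < z -> 0 < p2 z).

(** At an interior minimum of the gap [q1 (z + s) - q2 z] the slopes agree, so a single
    slope enters its second derivative as given by the two equations. *)
Lemma gap_min (s z : R) (Hs : 0 <= s) (Hz : 0 < z) (e : R) (He : 0 < e)
  (Hmin : forall y, 0 < y -> Rabs (y - z) < e ->
    q1 (z + s) - q2 z <= q1 (y + s) - q2 y) :
  p1 (z + s) = p2 z /\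
  0 <= (c1 - c2) * p2 z + (f (q2 z) - f (q1 (z + s))).
Proof.
  assert (Hm : 0 < Rmin e z) by (apply Rmin_pos; assumption).
  pose proof (Rmin_l e z). pose proof (Rmin_r e z).
  destruct (min_second_derivative (fun y => q1 (y + s) - q2 y)
    (fun y => p1 (y + s) - p2 y) z (Rmin e z)
    ((c1 * p1 (z + s) - f (q1 (z + s))) - (c2 * p2 z - f (q2 z)))) as [Hp Hdd].
  - exact Hm.
  - apply (continuity_minus (fun y => q1 (y + s))); [apply continuity_shift|];
      [apply H1|apply H2].
  - intros y Hy. apply Rabs_def2 in Hy.
    apply (is_derive_minus (fun y => q1 (y + s))); [apply is_derive_shift|].
    + apply (profile_derive_q _ _ _ _ H1). lra.
    + apply (profile_derive_q _ _ _ _ H2). lra.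
  - intros y Hy. assert (Hy' := Rabs_def2 _ _ Hy). apply Hmin; lra.
  - apply (is_derive_minus (fun y => p1 (y + s))); [apply is_derive_shift|].
    + apply (profile_derive_p _ _ _ _ H1). lra.
    + apply (profile_derive_p _ _ _ _ H2). lra.
  - assert (Hpp : p1 (z + s) = p2 z) by lra. rewrite Hpp in Hdd.
    split; [exact Hpp|lra].
Qed.

(** Where both functions are close to 1, [f] is decreasing, which makes the second
    derivative of the gap negative at a negative interior minimum.  The threshold
    [M] does not depend on the shift. *)
Lemma gap_far : exists M, 0 < M /\
  forall s, 0 <= s -> 0 <= q1 (M + s) - q2 M ->
  forall z, M <= z -> 0 <= q1 (z + s) - q2 z.
Proof.
  destruct Hd as [Hd0 Hdec].
  destruct (profile_infty _ _ _ _ H1 d ltac:(lra)) as [M1 HM1].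
  destruct (profile_infty _ _ _ _ H2 d ltac:(lra)) as [M2 HM2].
  set (M := Rmax 1 (Rmax M1 M2)).
  assert (HM : 1 <= M /\ M1 <= M /\ M2 <= M).
  { unfold M. pose proof (Rmax_l 1 (Rmax M1 M2)).
    pose proof (Rmax_r 1 (Rmax M1 M2)).
    pose proof (Rmax_l M1 M2). pose proof (Rmax_r M1 M2). lra. }
  exists M. split; [lra|]. intros s Hs HwM z Hz.
  apply Rnot_lt_le. intros Hneg.
  destruct (min_attained (fun y => q1 (y + s) - q2 y) 0 M z)
    as [zm [Hzm [Hm1 Hmin]]]; [| |exact Hz|exact Hneg|].
  - apply (continuity_minus (fun y => q1 (y + s))); [apply continuity_shift|];
      [apply H1|apply H2].
  - intros eps He.
    destruct (profile_infty _ _ _ _ H1 (eps / 2) ltac:(lra)) as [N1 HN1].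
    destruct (profile_infty _ _ _ _ H2 (eps / 2) ltac:(lra)) as [N2 HN2].
    exists (Rmax N1 N2). intros y Hy.
    pose proof (Rmax_l N1 N2). pose proof (Rmax_r N1 N2).
    assert (A1 := HN1 (y + s) ltac:(lra)). assert (A2 := HN2 y ltac:(lra)).
    apply Rabs_def2 in A1. apply Rabs_def2 in A2. apply Rabs_def1; lra.
  - cbv beta in Hm1, Hmin.
    assert (Hne : M < zm) by (destruct (Req_dec zm M) as [->|]; lra).
    destruct (gap_min s zm Hs ltac:(lra) (zm - M) ltac:(lra)) as [_ Hdd].
    { intros y _ Hy. apply Rabs_def2 in Hy. apply Hmin. lra. }
    assert (A1 := HM1 (zm + s) ltac:(lra)). apply Rabs_def2 in A1.
    assert (A2 := profile_le_1 _ _ _ _ Hfneg H2 zm ltac:(lra)).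
    assert (Hf : f (q2 zm) < f (q1 (zm + s))) by (apply Hdec; lra).
    destruct Hspeed as [->|[Hc Hp]]; [lra|].
    specialize (Hp zm ltac:(lra)). nra.
Qed.

Lemma no_touching (s z : R) (Hs : 0 < s) (Hz : 0 <= z)
  (Hge : forall y, 0 <= y -> 0 <= q1 (y + s) - q2 y) :
  0 < q1 (z + s) - q2 z.
Proof.
  assert (Hq1s : 0 < q1 s) by (apply (profile_pos _ _ _ _ H1); exact Hs).
  destruct (Hge z Hz) as [H|Hz']; [exact H|exfalso].
  assert (Hz0 : 0 < z).
  { destruct (Req_dec z 0) as [->|]; [|lra].
    rewrite Rplus_0_l, (profile_0 _ _ _ _ H2) in Hz'. lra. }
  destruct (gap_min s z ltac:(lra) Hz0 1 ltac:(lra)) as [Hp Hdd].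
  { intros y Hy _. rewrite <- Hz'. apply Hge. lra. }
  assert (Hqq : q1 (z + s) = q2 z) by lra.
  rewrite Hqq in Hdd.
  destruct Hspeed as [E|[Hc Hpp]].
  - (* Uniqueness, followed backward in [z], gives [q1 s = q2 0 = 0]. *)
    assert (H2' := H2). rewrite <- E in H2'.
    assert (H0 := profile_shift_unique f c1 q1 p1 q2 p2 s z 0 HL Hfneg H1 H2'
                    ltac:(lra) Hz ltac:(lra) Hqq Hp).
    rewrite Rplus_0_l, (profile_0 _ _ _ _ H2) in H0. lra.
  - specialize (Hpp z Hz0). nra.
Qed.

Lemma gap_large_shift : exists T, 0 < T /\
  forall s, T <= s -> forall z, 0 <= z -> 0 <= q1 (z + s) - q2 z.
Proof.
  destruct gap_far as [M [HM Hfar]].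
  destruct (continuity_ab_maj q2 0 M) as [m [Hm Hm0]];
    [lra|intros z _; apply H2|].
  assert (Hlt := profile_lt_1 _ _ _ _ HL Hfneg Hf1 H2 m ltac:(lra)).
  destruct (profile_infty _ _ _ _ H1 (1 - q2 m) ltac:(lra)) as [N HN].
  exists (Rmax 1 N). pose proof (Rmax_l 1 N). pose proof (Rmax_r 1 N).
  split; [lra|]. intros s Hs.
  assert (Hnear : forall z, 0 <= z <= M -> 0 <= q1 (z + s) - q2 z).
  { intros z Hz. assert (A := HN (z + s) ltac:(lra)). apply Rabs_def2 in A.
    assert (B := Hm z Hz). lra. }
  intros z Hz. destruct (Rle_or_lt z M) as [Hle|Hlt'].
  - apply Hnear. lra.
  - apply (Hfar s); [lra|apply Hnear; lra|lra].
Qed.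

(** Decrease the shift from a large value. A first bad shift [s0 > 0] would be
    one where the gap is nonnegative, hence positive; compactness of [[0, M]]
    and the maximum principle beyond [M] keep it nonnegative a little further. *)
Lemma sliding (s z : R) (Hs : 0 < s) (Hz : 0 <= z) : q2 z <= q1 (z + s).
Proof.
  apply Rnot_lt_le. intros Hbad.
  destruct gap_large_shift as [T [HT Hlarge]].
  destruct gap_far as [M [HM Hfar]].
  set (A := fun t => 0 < t /\ exists y, 0 <= y /\ q1 (y + t) - q2 y < 0).
  assert (HA : A s) by (split; [exact Hs|exists z; split; lra]).
  destruct (completeness A) as [s0 [Hub Hlub]].
  { exists T. intros t [_ [y [Hy Hlt]]]. apply Rnot_lt_le. intros Hgt.
    assert (B := Hlarge t ltac:(lra) y Hy). lra. }
  { exists s. exact HA. }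
  assert (Hs0 : 0 < s0) by (assert (B := Hub s HA); lra).
  assert (Hge : forall y, 0 <= y -> 0 <= q1 (y + s0) - q2 y).
  { intros y Hy. apply Rnot_lt_le. intros Hlt.
    destruct (near_of_continuity q1 (y + s0) (- (q1 (y + s0) - q2 y))
                (profile_cont_q _ _ _ _ H1 _)) as [r [Hr Hnear]]; [lra|].
    assert (B := Hnear (y + (s0 + r / 2)) ltac:(apply Rabs_def1; lra)).
    apply Rabs_def2 in B.
    assert (HA' : A (s0 + r / 2)).
    { split; [lra|]. exists y. split; [exact Hy|lra]. }
    apply Hub in HA'. lra. }
  destruct (continuity_ab_min (fun y => q1 (y + s0) - q2 y) 0 M)
    as [m [Hm Hm0]]; [lra| |].
  { intros y _. apply (continuity_minus (fun y => q1 (y + s0)));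
      [apply continuity_shift, H1|apply H2]. }
  cbv beta in Hm.
  assert (Hpos := no_touching s0 m Hs0 ltac:(lra) Hge).
  destruct (@Heine_cor2 q1 0 (M + s0) (fun y _ => profile_cont_q _ _ _ _ H1 y)
              (mkposreal _ Hpos)) as [r Hr].
  simpl in Hr. assert (Hr0 := cond_pos r).
  apply (Rlt_not_le s0 (s0 - Rmin r s0)).
  { assert (0 < Rmin r s0) by (apply Rmin_pos; lra). lra. }
  apply Hlub. intros t HAt. apply Rnot_lt_le. intros Ht.
  assert (Hts : t <= s0) by (apply Hub, HAt).
  destruct HAt as [Ht0 [y [Hy Hlt]]].
  pose proof (Rmin_l r s0).
  assert (Hnear : forall x, 0 <= x <= M -> 0 <= q1 (x + t) - q2 x).
  { intros x Hx.
    assert (B := Hr (x + t) (x + s0) ltac:(lra) ltac:(lra)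
                   ltac:(apply Rabs_def1; lra)).
    apply Rabs_def2 in B. assert (B' := Hm x Hx). lra. }
  destruct (Rle_or_lt y M) as [Hle|Hgt].
  - assert (B := Hnear y ltac:(lra)). lra.
  - assert (B := Hfar t ltac:(lra) (Hnear M ltac:(lra)) y ltac:(lra)). lra.
Qed.

(** If [q1] started with the smaller slope, it would fall below [q2]; by continuity
    it would stay below after a small shift. *)
Lemma slope_0_le : p2 0 <= p1 0.
Proof.
  apply Rnot_lt_le. intros Hlt.
  destruct (initial_descent (fun z => q1 z - q2 z) (fun z => p1 z - p2 z) 0)
    as [z [Hz Hdesc]].
  - apply (continuity_minus q1); [apply H1|apply H2].
  - apply (continuity_minus p1); [apply H1|apply H2].
  - intros z Hz. apply (is_derive_minus q1).
    + apply (profile_derive_q _ _ _ _ H1), Hz.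
    + apply (profile_derive_q _ _ _ _ H2), Hz.
  - lra.
  - rewrite (profile_0 _ _ _ _ H1), (profile_0 _ _ _ _ H2) in Hdesc.
    destruct (near_of_continuity q1 z (q2 z - q1 z)
                (profile_cont_q _ _ _ _ H1 z)) as [r [Hr Hnear]]; [lra|].
    assert (B := Hnear (z + r / 2) ltac:(apply Rabs_def1; lra)).
    apply Rabs_def2 in B.
    assert (C := sliding (r / 2) z ltac:(lra) ltac:(lra)). lra.
Qed.

End Sliding.

(** * Monotonicity and uniqueness *)

Lemma profile_slope_pos (f : R -> R) (d c : R) (q p : R -> R)
  (HL : lipschitz_unit f) (Hd : decreasing_below_one f d)
  (Hf0 : f 0 = 0) (Hf1 : f 1 = 0) (Hfneg : forall u, 1 < u -> f u < 0)
  (Hq : profile f c q p) :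
  forall z, 0 <= z -> 0 < p z.
Proof.
  assert (Hnn : forall z, 0 <= z -> 0 <= p z).
  { intros z Hz. apply Rnot_lt_le. intros Hneg.
    destruct (initial_descent q p z) as [y [Hy Hlt]]; try apply Hq; [|exact Hneg|].
    - intros y Hy. apply (profile_derive_q _ _ _ _ Hq). lra.
    - assert (B := sliding f d c c q p q p HL Hd Hf1 Hfneg Hq Hq
                     (or_introl eq_refl) (y - z) z ltac:(lra) Hz).
      replace (z + (y - z)) with y in B by ring. lra. }
  intros z Hz. destruct (Hnn z Hz) as [H|E]; [exact H|exfalso].
  destruct (Req_dec z 0) as [->|Hne].
  { pose proof (profile_slope_0_pos f c q p HL Hfneg Hf0 Hq). lra. }
  assert (Hz0 : 0 < z) by lra.
  (* [p] has an interior minimum at [z], so [p' z = - f (q z)] vanishes too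
     and the orbit is at rest. *)
  apply (profile_not_rest f c q p z HL Hfneg Hq Hz); [|symmetry; exact E].
  assert (Dp := profile_derive_p _ _ _ _ Hq z Hz0). rewrite <- E in Dp.
  assert (pr : derivable_pt p z) by (eexists; apply is_derive_Reals, Dp).
  assert (H0 : derive_pt p z pr = 0).
  { apply (deriv_minimum p 0 (z + 1)); [lra|lra|].
    intros y Hy _. rewrite <- E. apply Hnn. lra. }
  rewrite (derive_pt_eq_0 p z _ pr (proj1 (is_derive_Reals _ _ _) Dp)) in H0.
  lra.
Qed.

(** The initial slope [c / mu] increases with the speed, whereas sliding makes it
    nonincreasing. *)
Lemma speed_le (mu : R) (f : R -> R) (d c1 c2 : R) (q1 p1 q2 p2 : R -> R)
  (Hmu : 0 < mu) (HL : lipschitz_unit f) (Hd : decreasing_below_one f d)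
  (Hf0 : f 0 = 0) (Hf1 : f 1 = 0) (Hfneg : forall u, 1 < u -> f u < 0)
  (H1 : profile f c1 q1 p1) (H2 : profile f c2 q2 p2)
  (S1 : p1 0 = c1 / mu) (S2 : p2 0 = c2 / mu) :
  c2 <= c1.
Proof.
  apply Rnot_lt_le. intros Hlt.
  assert (B : p2 0 <= p1 0).
  { apply (slope_0_le f d c1 c2 q1 p1 q2 p2); try assumption.
    right. split; [exact Hlt|]. intros z Hz.
    apply (profile_slope_pos f d c2 q2 p2); try assumption. lra. }
  assert (c1 / mu < c2 / mu)
    by (apply Rmult_lt_compat_r; [apply Rinv_0_lt_compat|]; assumption).
  lra.
Qed.

Theorem theorem4p1 (mu : R) (Hmu : 0 < mu)
  (f df : R -> R) (Hf : C1_half_line f df)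
  (Hf0 : f 0 = 0) (Hf1 : f 1 = 0) (Hdf1 : df 1 < 0)
  (Hfneg : forall u, 1 < u -> f u < 0)
  (cs : R) (qs dqs ddqs : R -> R) (Hqs : semi_wave mu f cs qs dqs ddqs) :
  (forall x, 0 <= x -> 0 < dqs x) /\
  (forall (c : R) (q dq ddq : R -> R), semi_wave mu f c q dq ddq ->
     c = cs /\ forall z, 0 <= z -> q z = qs z).
Proof.
  assert (HL := C1_lipschitz_unit f df Hf).
  destruct (C1_decreasing_below_one f df Hf Hdf1) as [d Hd].
  assert (Ps := semi_wave_profile _ _ _ _ _ _ Hqs).
  assert (Ss : clamp dqs 0 = cs / mu)
    by (rewrite clamp_eq by lra; apply (semi_wave_slope _ _ _ _ _ _ Hqs)).
  split.
  - intros x Hx. rewrite <- (clamp_eq dqs) by exact Hx.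
    apply (profile_slope_pos f d cs (clamp qs) (clamp dqs)); assumption.
  - intros c q dq ddq Hq.
    assert (Pq := semi_wave_profile _ _ _ _ _ _ Hq).
    assert (Sq : clamp dq 0 = c / mu)
      by (rewrite clamp_eq by lra; apply (semi_wave_slope _ _ _ _ _ _ Hq)).
    assert (Hc : c = cs).
    { apply Rle_antisym.
      - apply (speed_le mu f d cs c (clamp qs) (clamp dqs) (clamp q) (clamp dq));
          assumption.
      - apply (speed_le mu f d c cs (clamp q) (clamp dq) (clamp qs) (clamp dqs));
          assumption. }
    split; [exact Hc|]. subst c. intros z Hz.
    rewrite <- (clamp_eq q), <- (clamp_eq qs), <- (Rplus_0_r z) at 1 by exact Hz.
    apply (profile_shift_unique f cs (clamp q) (clamp dq) (clamp qs) (clamp dqs)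
             0 0 z); try assumption; try lra.
    + rewrite Rplus_0_r, (profile_0 _ _ _ _ Pq), (profile_0 _ _ _ _ Ps).
      reflexivity.
    + rewrite Rplus_0_r, Sq, Ss. reflexivity.
Qed.
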